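(* Let $F:\mathcal{G}\to\mathcal{H}$ be a functor between semigroupal categories, with associativity constraints $\phi$ and $\psi$ respectively. Then the category $\mathcal{M}_l(F)$, with tensor product $(A,a)\otimes(B,b)=(A\otimes B,a|b)$ and associativity constraint $\phi_{(A,a),(B,b),(C,c)}=\phi_{A,B,C}$, is semigroupal. The forgetful functor $\mathcal{M}_l(F)\to\mathcal{G}$, $(A,a)\mapsto A$, is a strict semigroupal functor. The composition of the forgetful functor with $F$ is a semigroupal functor $\overline F:\mathcal{M}_l(F)\to\mathcal{H}$ with semigroupal structure $$\overline F_{(A,a),(B,b)}=a_B:F(A\otimes B)\to F(A)\otimes F(B).$$
   Context: A semigroupal category is a category with a tensor product functor and a natural associativity isomorphism $\phi_{X,Y,Z}:X\otimes(Y\otimes Z)\to(X\otimes Y)\otimes Z$ satisfying the pentagon axiom (a monoidal category without unit). A semigroupal functor $F:(\mathcal{C},\phi)\to(\mathcal{D},\psi)$ is a functor with natural isomorphisms $F_{X,Y}:F(X\otimes Y)\to F(X)\otimes F(Y)$ satisfying $\psi_{F(X),F(Y),F(Z)}\circ(F(X)\otimes F_{Y,Z})\circ F_{X,Y\otimes Z}=(F_{X,Y}\otimes F(Z))\circ F_{X\otimes Y,Z}\circ F(\phi_{X,Y,Z})$; it is strict if all $F_{X,Y}$ are identities. An object's name also denotes its identity morphism. For a mere functor $F:\mathcal{G}\to\mathcal{H}$ between semigroupal categories, the (left) multiplicant $\mathcal{M}_l(F)$ is the category of pairs $(A,a)$, where $A\in\mathcal{G}$ and $a$ is a family of isomorphisms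 $a_X:F(A\otimes X)\to F(A)\otimes F(X)$ natural in $X\in\mathcal{G}$. A morphism $(A,a)\to(B,b)$ is a morphism $f:A\to B$ in $\mathcal{G}$ with $(F(f)\otimes F(X))\circ a_X=b_X\circ F(f\otimes X)$ for all $X\in\mathcal{G}$. The family $(a|b)_X:F((A\otimes B)\otimes X)\to F(A\otimes B)\otimes F(X)$ is defined by $$(a_B\otimes F(X))\circ(a|b)_X\circ F(\phi_{A,B,X})=\psi_{F(A),F(B),F(X)}\circ(F(A)\otimes b_X)\circ a_{B\otimes X}.$$ The tensor product of morphisms of $\mathcal{M}_l(F)$ is that of $\mathcal{G}$. *)

(* Defs.v *)
From Stdlib Require Import ProofIrrelevance.

Set Implicit Arguments.
Unset Strict Implicit.
Unset Printing Implicit Defensive.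

Declare Scope cat_scope.
Delimit Scope cat_scope with cat.
Open Scope cat_scope.

Record Category := {
  ob :> Type;
  hom : ob -> ob -> Type;
  idm : forall X, hom X X;
  comp : forall X Y Z, hom Y Z -> hom X Y -> hom X Z;
  comp_id_l : forall X Y (f : hom X Y), comp (idm Y) f = f;
  comp_id_r : forall X Y (f : hom X Y), comp f (idm X) = f;
  comp_assoc : forall W X Y Z (h : hom Y Z) (g : hom X Y) (f : hom W X),
    comp h (comp g f) = comp (comp h g) f }.

Arguments idm {C} X : rename.
Arguments comp {C X Y Z} g f : rename.

Notation "X ~> Y" := (hom X Y) (at level 90, no associativity) : cat_scope.
Notation "g ∘ f" := (comp g f) (at level 40, left associativity) : cat_scope.

Record iso (C : Category) (X Y : C) := {
  iso_fwd :> X ~> Y;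
  iso_inv : Y ~> X;
  iso_invK : iso_inv ∘ iso_fwd = idm X;
  iso_fwdK : iso_fwd ∘ iso_inv = idm Y }.

Notation "X ≅ Y" := (iso X Y) (at level 90, no associativity) : cat_scope.

(* An inductive family, so that it can be asserted of a morphism [X ~> Y] whose
   endpoints are not definitionally equal; it forces [X = Y]. *)
Inductive is_identity (C : Category) (X : C) : forall Y : C, (X ~> Y) -> Prop :=
  is_identity_idm : is_identity (idm X).

Definition iso_sym (C : Category) (X Y : C) (i : X ≅ Y) : Y ≅ X :=
  {| iso_fwd := iso_inv i; iso_inv := i;
     iso_invK := iso_fwdK i; iso_fwdK := iso_invK i |}.

Definition iso_comp (C : Category) (X Y Z : C) (j : Y ≅ Z) (i : X ≅ Y) : X ≅ Z.
Proof.
refine {| iso_fwd := j ∘ i; iso_inv := iso_inv i ∘ iso_inv j |}.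
- rewrite comp_assoc, <- (comp_assoc (iso_inv i)), iso_invK, comp_id_r.
  apply iso_invK.
- rewrite comp_assoc, <- (comp_assoc (iso_fwd j)), iso_fwdK, comp_id_r.
  apply iso_fwdK.
Defined.

Record Functor (C D : Category) := {
  fob :> C -> D;
  fmap : forall X Y : C, (X ~> Y) -> (fob X ~> fob Y);
  fmap_id : forall X : C, fmap (idm X) = idm (fob X);
  fmap_comp : forall (X Y Z : C) (g : Y ~> Z) (f : X ~> Y),
    fmap (g ∘ f) = fmap g ∘ fmap f }.

Arguments fmap {C D} F {X Y} f : rename.

Definition functor_comp (C D E : Category) (K : Functor D E) (F : Functor C D) :
  Functor C E.
Proof.
refine {| fob := fun X => K (F X); fmap := fun X Y f => fmap K (fmap F f) |}.
- intros X. rewrite fmap_id. apply fmap_id.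
- intros X Y Z g f. rewrite fmap_comp. apply fmap_comp.
Defined.

Definition fmap_iso (C D : Category) (F : Functor C D) (X Y : C) (i : X ≅ Y) :
  F X ≅ F Y.
Proof.
refine {| iso_fwd := fmap F i; iso_inv := fmap F (iso_inv i) |}.
- rewrite <- fmap_comp, iso_invK. apply fmap_id.
- rewrite <- fmap_comp, iso_fwdK. apply fmap_id.
Defined.

Record SemigroupalData (C : Category) := {
  tens_data : C -> C -> C;
  thom_data : forall X X' Y Y' : C,
    (X ~> X') -> (Y ~> Y') -> (tens_data X Y ~> tens_data X' Y');
  assoc_data : forall X Y Z : C,
    tens_data X (tens_data Y Z) ≅ tens_data (tens_data X Y) Z }.

Record IsSemigroupal (C : Category) (S : SemigroupalData C) : Prop := {
  is_thom_id : forall X Y : C,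
    thom_data S (idm X) (idm Y) = idm (tens_data S X Y);
  is_thom_comp : forall (X X' X'' Y Y' Y'' : C)
      (f' : X' ~> X'') (f : X ~> X') (g' : Y' ~> Y'') (g : Y ~> Y'),
    thom_data S (f' ∘ f) (g' ∘ g) = thom_data S f' g' ∘ thom_data S f g;
  is_assoc_nat : forall (X X' Y Y' Z Z' : C)
      (f : X ~> X') (g : Y ~> Y') (h : Z ~> Z'),
    assoc_data S X' Y' Z' ∘ thom_data S f (thom_data S g h)
      = thom_data S (thom_data S f g) h ∘ assoc_data S X Y Z;
  is_pentagon : forall W X Y Z : C,
    assoc_data S (tens_data S W X) Y Z ∘ assoc_data S W X (tens_data S Y Z)
      = thom_data S (assoc_data S W X Y) (idm Z)
        ∘ assoc_data S W (tens_data S X Y) Z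
        ∘ thom_data S (idm W) (assoc_data S X Y Z) }.

Record SemigroupalCategory := {
  sg_cat :> Category;
  sg_data : SemigroupalData sg_cat;
  sg_laws : IsSemigroupal sg_data }.

Definition tens (C : SemigroupalCategory) (X Y : C) : C :=
  tens_data (sg_data C) X Y.
Definition thom (C : SemigroupalCategory) (X X' Y Y' : C)
    (f : X ~> X') (g : Y ~> Y') : tens X Y ~> tens X' Y' :=
  thom_data (sg_data C) f g.
Definition assoc (C : SemigroupalCategory) (X Y Z : C) :
    tens X (tens Y Z) ≅ tens (tens X Y) Z :=
  assoc_data (sg_data C) X Y Z.

Notation "X ⊗ Y" := (tens X Y) (at level 34, left associativity) : cat_scope.
Notation "f ⊗₁ g" := (thom f g) (at level 34, left associativity) : cat_scope.

Lemma thom_id (C : SemigroupalCategory) (X Y : C) : idm X ⊗₁ idm Y = idm (X ⊗ Y).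
Proof. apply (is_thom_id (sg_laws C)). Qed.

Lemma thom_comp (C : SemigroupalCategory) (X X' X'' Y Y' Y'' : C)
    (f' : X' ~> X'') (f : X ~> X') (g' : Y' ~> Y'') (g : Y ~> Y') :
  (f' ∘ f) ⊗₁ (g' ∘ g) = (f' ⊗₁ g') ∘ (f ⊗₁ g).
Proof. apply (is_thom_comp (sg_laws C)). Qed.

Definition thom_iso (C : SemigroupalCategory) (X X' Y Y' : C)
  (i : X ≅ X') (j : Y ≅ Y') : X ⊗ Y ≅ X' ⊗ Y'.
Proof.
refine {| iso_fwd := i ⊗₁ j; iso_inv := iso_inv i ⊗₁ iso_inv j |};
  rewrite <- thom_comp.
- rewrite !iso_invK. apply thom_id.
- rewrite !iso_fwdK. apply thom_id.
Defined.

Definition iso_id (C : Category) (X : C) : X ≅ X :=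
  {| iso_fwd := idm X; iso_inv := idm X;
     iso_invK := comp_id_l (idm X); iso_fwdK := comp_id_l (idm X) |}.

Record IsSemigroupalFunctor (C D : SemigroupalCategory) (F : Functor C D)
    (F2 : forall X Y : C, F (X ⊗ Y) ≅ F X ⊗ F Y) : Prop := {
  sgf_nat : forall (X X' Y Y' : C) (f : X ~> X') (g : Y ~> Y'),
    F2 X' Y' ∘ fmap F (f ⊗₁ g) = (fmap F f ⊗₁ fmap F g) ∘ F2 X Y;
  sgf_assoc : forall X Y Z : C,
    assoc (F X) (F Y) (F Z) ∘ (idm (F X) ⊗₁ F2 Y Z) ∘ F2 X (Y ⊗ Z)
      = (F2 X Y ⊗₁ idm (F Z)) ∘ F2 (X ⊗ Y) Z ∘ fmap F (assoc X Y Z) }.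

Definition IsStrict (C D : SemigroupalCategory) (F : Functor C D)
    (F2 : forall X Y : C, F (X ⊗ Y) ≅ F X ⊗ F Y) : Prop :=
  forall X Y : C, is_identity (F2 X Y).

Section Multiplicant.
Variables (G H : SemigroupalCategory) (F : Functor G H).

Definition ml_family (A : G) : Type := forall X : G, F (A ⊗ X) ≅ F A ⊗ F X.

Definition ml_natural (A : G) (a : ml_family A) : Prop :=
  forall (X Y : G) (g : X ~> Y),
    a Y ∘ fmap F (idm A ⊗₁ g) = (idm (F A) ⊗₁ fmap F g) ∘ a X.

Definition ml_compat (A B : G) (a : ml_family A) (b : ml_family B)
    (f : A ~> B) : Prop :=
  forall X : G,
    (fmap F f ⊗₁ idm (F X)) ∘ a X = b X ∘ fmap F (f ⊗₁ idm X).

Record ml_ob := MlOb {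
  ml_car : G;
  ml_fam : ml_family ml_car;
  ml_nat : ml_natural ml_fam }.

Record ml_hom (P Q : ml_ob) := MlHom {
  ml_mor : ml_car P ~> ml_car Q;
  ml_comm : ml_compat (ml_fam P) (ml_fam Q) ml_mor }.

Lemma ml_hom_eq (P Q : ml_ob) (f g : ml_hom P Q) : ml_mor f = ml_mor g -> f = g.
Proof.
destruct f as [f Hf], g as [g Hg]; simpl; intros e; subst g.
f_equal; apply proof_irrelevance.
Qed.

Lemma ml_compat_id (A : G) (a : ml_family A) : ml_compat a a (idm A).
Proof.
intros X; rewrite fmap_id, !thom_id, fmap_id.
now rewrite comp_id_l, comp_id_r.
Qed.

Lemma ml_compat_comp (A B C : G)
    (a : ml_family A) (b : ml_family B) (c : ml_family C)
    (g : B ~> C) (f : A ~> B) :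
  ml_compat b c g -> ml_compat a b f -> ml_compat a c (g ∘ f).
Proof.
intros Hg Hf X; specialize (Hg X); specialize (Hf X).
rewrite fmap_comp, <- (comp_id_l (idm (F X))), <- (comp_id_l (idm X)).
rewrite !thom_comp, fmap_comp, <- comp_assoc, Hf.
now rewrite comp_assoc, Hg, comp_assoc.
Qed.

Definition Ml : Category.
Proof.
refine {|
  ob := ml_ob;
  hom := ml_hom;
  idm := fun P => MlHom (ml_compat_id (ml_fam P));
  comp := fun P Q R g f => MlHom (ml_compat_comp (ml_comm g) (ml_comm f)) |};
  intros; apply ml_hom_eq; simpl.
- apply comp_id_l.
- apply comp_id_r.
- apply comp_assoc.
Defined.

Definition ml_forget : Functor Ml G :=
  {| fob := ml_car : Ml -> G;
     fmap := fun (P Q : Ml) (f : P ~> Q) => ml_mor f;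
     fmap_id := fun P => eq_refl;
     fmap_comp := fun P Q R g f => eq_refl |}.

(* The family [a|b], obtained by solving its defining equation for [(a|b)_X];
   see [ml_mul_spec]. *)
Definition ml_mul (A B : G) (a : ml_family A) (b : ml_family B) :
    ml_family (A ⊗ B) :=
  fun X =>
    iso_comp (iso_sym (thom_iso (a B) (iso_id (F X))))
   (iso_comp (assoc (F A) (F B) (F X))
   (iso_comp (thom_iso (iso_id (F A)) (b X))
   (iso_comp (a (B ⊗ X))
             (iso_sym (fmap_iso F (assoc A B X)))))).

Lemma ml_mul_spec (A B : G) (a : ml_family A) (b : ml_family B) (X : G)
    (c : F (A ⊗ B ⊗ X) ~> F (A ⊗ B) ⊗ F X) :
  (a B ⊗₁ idm (F X)) ∘ c ∘ fmap F (assoc A B X)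
    = assoc (F A) (F B) (F X) ∘ (idm (F A) ⊗₁ b X) ∘ a (B ⊗ X)
  <-> c = ml_mul a b X.
Proof.
pose (u := thom_iso (a B) (iso_id (F X))).
pose (v := fmap_iso F (assoc A B X)).
change (a B ⊗₁ idm (F X)) with (iso_fwd u).
change (fmap F (assoc A B X)) with (iso_fwd v).
set (w := assoc _ _ _ ∘ _ ∘ _).
assert (E : iso_fwd (ml_mul a b X) = iso_inv u ∘ w ∘ iso_inv v).
{ unfold ml_mul, w; simpl; now rewrite !comp_assoc. }
rewrite E; split; intros h.
- rewrite <- h, !comp_assoc, iso_invK, comp_id_l.
  now rewrite <- comp_assoc, iso_fwdK, comp_id_r.
- rewrite h, !comp_assoc, iso_fwdK, comp_id_l.
  now rewrite <- comp_assoc, iso_invK, comp_id_r.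
Qed.

(* The tensor product [(A ⊗ B, a|b)] and the associativity constraint of [G], as
   structure on [Ml]. The hypotheses say that this is well defined; they are not
   established here. *)
Definition ml_data
    (mul_nat : forall P Q : ml_ob, ml_natural (ml_mul (ml_fam P) (ml_fam Q)))
    (thom_compat : forall (P P' Q Q' : ml_ob) (f : ml_hom P P') (g : ml_hom Q Q'),
       ml_compat (ml_mul (ml_fam P) (ml_fam Q)) (ml_mul (ml_fam P') (ml_fam Q'))
         (ml_mor f ⊗₁ ml_mor g))
    (assoc_compat : forall P Q R : ml_ob,
       ml_compat (ml_mul (ml_fam P) (ml_mul (ml_fam Q) (ml_fam R)))
         (ml_mul (ml_mul (ml_fam P) (ml_fam Q)) (ml_fam R))
         (assoc (ml_car P) (ml_car Q) (ml_car R)))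
    (assoc_inv_compat : forall P Q R : ml_ob,
       ml_compat (ml_mul (ml_mul (ml_fam P) (ml_fam Q)) (ml_fam R))
         (ml_mul (ml_fam P) (ml_mul (ml_fam Q) (ml_fam R)))
         (iso_inv (assoc (ml_car P) (ml_car Q) (ml_car R)))) :
  SemigroupalData Ml.
Proof.
pose (T := (fun P Q => MlOb (mul_nat P Q)) : Ml -> Ml -> Ml).
refine {|
  tens_data := fun P Q : Ml => MlOb (mul_nat P Q) : Ml;
  thom_data := fun (P P' Q Q' : Ml) (f : P ~> P') (g : Q ~> Q') =>
    MlHom (P := T P Q) (Q := T P' Q') (thom_compat P P' Q Q' f g);
  assoc_data := fun P Q R : Ml => {|
    iso_fwd := MlHom (P := T P (T Q R)) (Q := T (T P Q) R)
      (assoc_compat P Q R) : hom (c := Ml) _ _;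
    iso_inv := MlHom (P := T (T P Q) R) (Q := T P (T Q R))
      (assoc_inv_compat P Q R) : hom (c := Ml) _ _ |} |};
  apply ml_hom_eq; simpl.
- apply iso_invK.
- apply iso_fwdK.
Defined.

End Multiplicant.

(* Main.v *)
(** Every condition on [a|b] is checked after composing with the isomorphisms
    [a_B ⊗ F X] and [F φ] of its defining equation, which replaces it by [a], [b]
    and [ψ]. Compatibility of [φ] with the families thereby reduces to the
    pentagon of [G] on one side and the pentagon of [H] on the other, and the
    defining equation itself is the coherence axiom of [F ∘ forget]. *)

Require Import Defs.

Set Implicit Arguments.
Unset Strict Implicit.

Lemma iso_monic (C : Category) (X Y Z : C) (i : Y ≅ Z) (f g : X ~> Y) :
  i ∘ f = i ∘ g -> f = g.
Proof.
intros e; rewrite <- (comp_id_l f), <- (comp_id_l g), <- (iso_invK i).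
now rewrite <- !comp_assoc, e.
Qed.

Lemma iso_epic (C : Category) (X Y Z : C) (i : X ≅ Y) (f g : Y ~> Z) :
  f ∘ i = g ∘ i -> f = g.
Proof.
intros e; rewrite <- (comp_id_r f), <- (comp_id_r g), <- (iso_fwdK i).
now rewrite !comp_assoc, e.
Qed.

Section Semigroupal.
Variable C : SemigroupalCategory.

Lemma assoc_nat (X X' Y Y' Z Z' : C) (f : X ~> X') (g : Y ~> Y') (h : Z ~> Z') :
  assoc X' Y' Z' ∘ (f ⊗₁ (g ⊗₁ h)) = (f ⊗₁ g ⊗₁ h) ∘ assoc X Y Z.
Proof. apply (is_assoc_nat (sg_laws C)). Qed.

Lemma pentagon (W X Y Z : C) :
  assoc (W ⊗ X) Y Z ∘ assoc W X (Y ⊗ Z)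
    = (assoc W X Y ⊗₁ idm Z) ∘ (assoc W (X ⊗ Y) Z ∘ (idm W ⊗₁ assoc X Y Z)).
Proof. rewrite comp_assoc; apply (is_pentagon (sg_laws C)). Qed.

Lemma thom_comp_l (X X' X'' Y : C) (f' : X' ~> X'') (f : X ~> X') :
  (f' ∘ f) ⊗₁ idm Y = (f' ⊗₁ idm Y) ∘ (f ⊗₁ idm Y).
Proof. now rewrite <- thom_comp, comp_id_l. Qed.

Lemma thom_comp_r (X Y Y' Y'' : C) (g' : Y' ~> Y'') (g : Y ~> Y') :
  idm X ⊗₁ (g' ∘ g) = (idm X ⊗₁ g') ∘ (idm X ⊗₁ g).
Proof. now rewrite <- thom_comp, comp_id_l. Qed.

Lemma thom_split_lr (X X' Y Y' : C) (f : X ~> X') (g : Y ~> Y') :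
  (f ⊗₁ idm Y') ∘ (idm X ⊗₁ g) = f ⊗₁ g.
Proof. now rewrite <- thom_comp, comp_id_l, comp_id_r. Qed.

Lemma thom_split_rl (X X' Y Y' : C) (f : X ~> X') (g : Y ~> Y') :
  (idm X' ⊗₁ g) ∘ (f ⊗₁ idm Y) = f ⊗₁ g.
Proof. now rewrite <- thom_comp, comp_id_l, comp_id_r. Qed.

End Semigroupal.

Section Multiplicant.
Variables (G H : SemigroupalCategory) (F : Functor G H).

Lemma ml_mul_eq (A B : G) (a : ml_family F A) (b : ml_family F B) (X : G) :
  (a B ⊗₁ idm (F X)) ∘ (ml_mul a b X ∘ fmap F (assoc A B X))
    = assoc (F A) (F B) (F X) ∘ ((idm (F A) ⊗₁ b X) ∘ a (B ⊗ X)).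
Proof. rewrite !comp_assoc; now apply ml_mul_spec. Qed.

(** Combines the two conditions on families: $h$ an identity gives [ml_compat], $f$ an identity
    gives [ml_natural]. Its stability under [ml_mul] yields both the naturality of $a|b$ and the
    compatibility of $f\otimes g$. *)
Definition ml_binatural (A A' : G) (a : ml_family F A) (a' : ml_family F A')
    (f : A ~> A') : Prop :=
  forall (X Y : G) (h : X ~> Y),
    a' Y ∘ fmap F (f ⊗₁ h) = (fmap F f ⊗₁ fmap F h) ∘ a X.

(** Factor $f\otimes h$ as $f\otimes X$ followed by $h$ in the second variable: compatibility of $f$
    treats the first factor, naturality of the target family the second. *)
Lemma ml_hom_binatural (P Q : ml_ob F) (f : ml_hom P Q) :
  ml_binatural (ml_fam P) (ml_fam Q) (ml_mor f).
Proof.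
intros X Y h.
rewrite <- (thom_split_rl (ml_mor f) h), fmap_comp, comp_assoc, (ml_nat Q h).
rewrite <- comp_assoc, <- (ml_comm f X), comp_assoc.
now rewrite thom_split_rl.
Qed.

Lemma ml_binatural_compat (A A' : G) (a : ml_family F A) (a' : ml_family F A')
    (f : A ~> A') :
  ml_binatural a a' f -> ml_compat a a' f.
Proof. intros n X; now rewrite n, fmap_id. Qed.

Lemma ml_binatural_id (P : ml_ob F) :
  ml_binatural (ml_fam P) (ml_fam P) (idm (ml_car P)).
Proof. exact (ml_hom_binatural (P := P) (MlHom (ml_compat_id (ml_fam P)))). Qed.

Lemma ml_mul_binatural (A A' B B' : G)
    (a : ml_family F A) (a' : ml_family F A')
    (b : ml_family F B) (b' : ml_family F B') (f : A ~> A') (g : B ~> B') :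
  ml_binatural a a' f -> ml_binatural b b' g ->
  ml_binatural (ml_mul a b) (ml_mul a' b') (f ⊗₁ g).
Proof.
intros Ha Hb X Y h.
apply (iso_monic (i := thom_iso (a' B') (iso_id (F Y)))).
apply (iso_epic (i := fmap_iso F (assoc A B X))).
cbn [iso_fwd thom_iso fmap_iso iso_id].
(* Both sides meet here: the left by naturality of $\phi$ and the equation for $a'|b'$, the right by
   naturality of $\psi$ and the equation for $a|b$. *)
transitivity (assoc (F A') (F B') (F Y)
  ∘ ((fmap F f ⊗₁ (fmap F g ⊗₁ fmap F h)) ∘ ((idm (F A) ⊗₁ b X) ∘ a (B ⊗ X)))).
- rewrite <- !comp_assoc, <- fmap_comp, <- assoc_nat, fmap_comp.
  rewrite (comp_assoc (ml_mul a' b' Y)), (comp_assoc (a' B' ⊗₁ _)), ml_mul_eq.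
  rewrite <- !comp_assoc, Ha; f_equal.
  rewrite !comp_assoc; f_equal.
  rewrite <- !thom_comp, Hb.
  now rewrite comp_id_l, comp_id_r.
- rewrite comp_assoc, assoc_nat, <- (comp_assoc _ (assoc _ _ _)), <- ml_mul_eq.
  rewrite !comp_assoc; do 2 f_equal.
  rewrite <- !thom_comp, Ha.
  now rewrite comp_id_l, comp_id_r.
Qed.

Lemma ml_mul_natural (P Q : ml_ob F) :
  ml_natural (ml_mul (ml_fam P) (ml_fam Q)).
Proof.
intros X Y h.
pose proof (ml_mul_binatural (ml_binatural_id P) (ml_binatural_id Q) h) as e.
now rewrite thom_id, fmap_id in e.
Qed.

Lemma ml_assoc_compat (P B C : ml_ob F) :
  ml_compat (ml_mul (ml_fam P) (ml_mul (ml_fam B) (ml_fam C)))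
    (ml_mul (ml_mul (ml_fam P) (ml_fam B)) (ml_fam C))
    (assoc (ml_car P) (ml_car B) (ml_car C)).
Proof.
destruct P as [A a na], B as [B b nb], C as [C c nc]; simpl; intros X.
(* The source becomes $F(A\otimes(B\otimes(C\otimes X)))$, the start of the pentagon of [G]; the
   target becomes $((FA\otimes FB)\otimes FC)\otimes FX$, the end of the pentagon of [H]. *)
apply (iso_epic (i := fmap_iso F (assoc A (B ⊗ C) X))).
apply (iso_epic (i := fmap_iso F (thom_iso (iso_id A) (assoc B C X)))).
apply (iso_monic (i := thom_iso (ml_mul a b C) (iso_id (F X)))).
apply (iso_monic (i := thom_iso (thom_iso (a B) (iso_id (F C))) (iso_id (F X)))).
cbn [iso_fwd thom_iso fmap_iso iso_id].
transitivity ((assoc (F A) (F B) (F C) ⊗₁ idm (F X))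
  ∘ (assoc (F A) (F B ⊗ F C) (F X) ∘ (idm (F A) ⊗₁ assoc (F B) (F C) (F X)))
  ∘ ((idm (F A) ⊗₁ (idm (F B) ⊗₁ c X)) ∘ (idm (F A) ⊗₁ b (C ⊗ X))
     ∘ a (B ⊗ (C ⊗ X)))).
(* The equation for $a|b$ at $C$, tensored with $FX$, removes $F\phi_{A,B,C}$. *)
- transitivity
    (((assoc (F A) (F B) (F C) ∘ ((idm (F A) ⊗₁ b C) ∘ a (B ⊗ C))) ⊗₁ idm (F X))
     ∘ (ml_mul a (ml_mul b c) X ∘ fmap F (assoc A (B ⊗ C) X))
     ∘ fmap F (idm A ⊗₁ assoc B C X)).
  { rewrite <- ml_mul_eq, !thom_comp_l; now rewrite !comp_assoc. }
  rewrite !thom_comp_l, <- !comp_assoc; f_equal.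
  (* Unfold $a|(b|c)$; naturality of $a$ then carries $\phi_{B,C,X}$ inside $FA\otimes-$, where the
     equation for $b|c$ applies. *)
  rewrite (comp_assoc (ml_mul a _ X)), (comp_assoc (a (B ⊗ C) ⊗₁ _)), ml_mul_eq.
  rewrite <- !comp_assoc, na, !comp_assoc; f_equal.
  rewrite <- assoc_nat, <- !comp_assoc; f_equal.
  rewrite <- !thom_comp_r; f_equal.
  apply ml_mul_eq.
- rewrite <- pentagon.
  transitivity (((a B ⊗₁ idm (F C)) ⊗₁ idm (F X))
    ∘ ((ml_mul a b C ⊗₁ idm (F X))
       ∘ (ml_mul (ml_mul a b) c X ∘ fmap F (assoc (A ⊗ B) C X)))
    ∘ fmap F (assoc A B (C ⊗ X))).
  + rewrite ml_mul_eq, !comp_assoc, <- assoc_nat, thom_id.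
    (* Interchange $a_B$ with $c_X$, so that $a_B$ meets $(a|b)_{C\otimes X}$. *)
    rewrite <- (comp_assoc _ _ (idm _ ⊗₁ c X)), thom_split_lr.
    rewrite <- (thom_split_rl (a B)), <- !comp_assoc, ml_mul_eq.
    f_equal; rewrite <- (thom_id (F A) (F B)).
    now rewrite !comp_assoc, assoc_nat.
  + rewrite <- !comp_assoc; do 3 f_equal.
    rewrite <- !fmap_comp; f_equal.
    apply pentagon.
Qed.

(** Makes $\phi^{-1}$ a morphism of [Ml], so that $\phi$ is invertible there. *)
Lemma ml_compat_inv (A B : G) (a : ml_family F A) (b : ml_family F B)
    (i : A ≅ B) :
  ml_compat a b i -> ml_compat b a (iso_inv i).
Proof.
intros n X.
apply (iso_monic (i := thom_iso (fmap_iso F i) (iso_id (F X)))).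
apply (iso_epic (i := fmap_iso F (thom_iso i (iso_id X)))); simpl.
rewrite !comp_assoc, <- thom_comp_l, <- fmap_comp, iso_fwdK, fmap_id.
rewrite thom_id, comp_id_l, <- !comp_assoc, <- fmap_comp, <- thom_comp_l.
rewrite iso_invK, thom_id, fmap_id, comp_id_r.
now rewrite n.
Qed.

End Multiplicant.

Unset Implicit Arguments.

Theorem theorem3p0p1 (G H : SemigroupalCategory) (F : Functor G H) :
  exists (mul_nat : forall P Q : ml_ob F,
            ml_natural (ml_mul (ml_fam P) (ml_fam Q)))
         (thom_compat : forall (P P' Q Q' : ml_ob F)
              (f : ml_hom P P') (g : ml_hom Q Q'),
            ml_compat (ml_mul (ml_fam P) (ml_fam Q))
              (ml_mul (ml_fam P') (ml_fam Q')) (ml_mor f ⊗₁ ml_mor g))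
         (assoc_compat : forall P Q R : ml_ob F,
            ml_compat (ml_mul (ml_fam P) (ml_mul (ml_fam Q) (ml_fam R)))
              (ml_mul (ml_mul (ml_fam P) (ml_fam Q)) (ml_fam R))
              (assoc (ml_car P) (ml_car Q) (ml_car R)))
         (assoc_inv_compat : forall P Q R : ml_ob F,
            ml_compat (ml_mul (ml_mul (ml_fam P) (ml_fam Q)) (ml_fam R))
              (ml_mul (ml_fam P) (ml_mul (ml_fam Q) (ml_fam R)))
              (iso_inv (assoc (ml_car P) (ml_car Q) (ml_car R))))
         (laws : IsSemigroupal
            (ml_data mul_nat thom_compat assoc_compat assoc_inv_compat)),
    let M : SemigroupalCategory := Build_SemigroupalCategory laws in
    (exists U2 : forall P Q : M,
         ml_forget F (P ⊗ Q) ≅ ml_forget F P ⊗ ml_forget F Q,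
       @IsSemigroupalFunctor M G (ml_forget F) U2
       /\ @IsStrict M G (ml_forget F) U2)
    /\ @IsSemigroupalFunctor M H (functor_comp F (ml_forget F))
         (fun P Q : M => ml_fam P (ml_car Q)).
Proof.
exists (ml_mul_natural (F := F)).
exists (fun P P' Q Q' f g =>
  ml_binatural_compat (ml_mul_binatural (ml_hom_binatural f) (ml_hom_binatural g))).
exists (ml_assoc_compat (F := F)).
exists (fun P Q R => ml_compat_inv (ml_assoc_compat P Q R)).
unshelve eexists.
(* Morphisms of [Ml] are determined by their underlying arrows, so the laws are inherited from
   [G]. *)
{ split; intros; apply ml_hom_eq; simpl.
  - apply thom_id.
  - apply thom_comp.
  - apply assoc_nat.
  - rewrite <- comp_assoc; apply pentagon. }
intros M; split.
- exists (fun P Q => iso_id (ml_car P ⊗ ml_car Q)).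
  split; [split|]; simpl.
  + intros; rewrite comp_id_l; symmetry; apply comp_id_r.
  + intros; rewrite !comp_id_r, thom_id, comp_id_r.
    now rewrite thom_id, !comp_id_l.
  + intros P Q; apply is_identity_idm.
- split.
  (* Binaturality of $f$, evaluated at the arrow underlying $g$. *)
  + intros P P' Q Q' f g; apply (ml_hom_binatural f).
  + intros P Q R; symmetry.
    exact (proj2 (ml_mul_spec (ml_fam P) (ml_fam Q) _) eq_refl).
Qed.
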